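(* Choose any decay factor $\alpha\in(0,1)$, failure probability $p\in(0,1)$, error parameter $c\in(0,\tfrac12]$, and any functions $\delta(n)\in(0,1)$ and $m(n)\in\Omega(n)\cap O(n^2)$. Consider any (possibly randomized) algorithm in the arc-centric graph query model which, for an arbitrary directed graph $G$ with $O(m)$ edges and $O(n)$ nodes and any source node $s$ of $G$, with probability at least $1-p$ gives an estimate $\hat\pi(s,\cdot)$ of the PPR vector $\pi(s,\cdot)$ satisfying $|\hat\pi(s,v)-\pi(s,v)|\le c\cdot\pi(s,v)$ for each node $v$ with $\pi(s,v)\ge\delta$. Then there exist a graph $\mathrm U$ and a source node $s$ such that (i) $\mathrm U$ contains $O(m)$ edges and $O(n)$ nodes; (ii) the algorithm requires $\Omega\!\left(\min\left(m,\frac{\log(1/\delta)}{\delta}\right)\right)$ queries to succeed in expectation.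
   Context: Graphs are directed, without parallel edges (self-loops allowed). Personalized PageRank (PPR): for a decay factor $\alpha\in(0,1)$, an $\alpha$-decay random walk from $s$ at each step stops at the current node with probability $\alpha$, and with probability $1-\alpha$ moves to a uniformly random out-neighbour of the current node. $\pi(s,t)$ is the probability that the walk started at $s$ terminates at $t$. It is assumed, without loss of generality, that graphs have no dangling nodes (nodes without out-neighbours). The parameters $\alpha,p,c$ are treated as constants in the asymptotic notation. Arc-centric graph query model: nodes carry labels in $\{1,\dots,|V|\}$; the out-edges (in-edges) of a node $v$ are indexed by $1,\dots,d_{out}(v)$ (resp. $1,\dots,d_{in}(v)$); a graph instance includes these labels. The algorithm is given $s$ (which is covered) and accesses $G$ only via unit-cost queries: JUMP() returns a uniformly random node and marks it covered; INDEG$(v)$/OUTDEG$(v)$ return the in-/out-degree of a covered node $v$; ADJ$_{in}(v,i)$/ADJ$_{out}(v,i)$ return the $i$-th in-/out-neighbour of a covered node $v$ (which then becomes covered).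
   Formalization: The query bound is stated for max(1, expected queries), so it says nothing where min(m, log(1/δ)/δ) is below a constant; there the literal claim can fail (α=1/2, δ=0.9, c=1/2: the constant estimate 0.95 needs no queries). *)

(* Defs.v *)
From HB Require Import structures.
From mathcomp Require Import all_boot all_order all_algebra.
From mathcomp Require Import all_classical all_reals all_analysis.

Set Implicit Arguments.
Unset Strict Implicit.
Unset Printing Implicit Defensive.

Import Order.TTheory GRing.Theory Num.Theory.
Import numFieldNormedType.Exports.

Local Open Scope classical_set_scope.
Local Open Scope ring_scope.

(* A labelled directed graph instance: the nodes are their own labels, and the
   orders of the neighbour lists are the indexings of the out- and in-edges.
   Node labels and edge indices start at 0.  Self-loops are allowed; [uniq]
   excludes parallel edges. *)
Record digraph (N : nat) := Digraph {
  out_nbrs : 'I_N -> seq 'I_N;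
  in_nbrs : 'I_N -> seq 'I_N;
  out_nbrs_uniq : forall v, uniq (out_nbrs v);
  in_nbrs_uniq : forall v, uniq (in_nbrs v);
  in_nbrsE : forall u v, (u \in in_nbrs v) = (v \in out_nbrs u);
  no_dangling : forall v, out_nbrs v != [::]
}.

Definition outdeg (N : nat) (G : digraph N) (v : 'I_N) : nat :=
  size (out_nbrs G v).

Definition indeg (N : nat) (G : digraph N) (v : 'I_N) : nat :=
  size (in_nbrs G v).

Definition n_edges (N : nat) (G : digraph N) : nat :=
  (\sum_(v < N) outdeg G v)%N.

(* Probability that the alpha-decay walk from s makes at least k moves and is
   at v after the k-th one. *)
Fixpoint walk_at (R : realType) (alpha : R) (N : nat) (G : digraph N)
    (s : 'I_N) (k : nat) (v : 'I_N) : R :=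
  if k is k'.+1 then
    \sum_(u < N | v \in out_nbrs G u)
      walk_at alpha G s k' u * (1 - alpha) / (outdeg G u)%:R
  else (v == s)%:R.

(* The walk terminates at t by stopping there after some number k of moves. *)
Definition ppr (R : realType) (alpha : R) (N : nat) (G : digraph N)
    (s t : 'I_N) : R :=
  limn (series (fun k => walk_at alpha G s k t * alpha)).

Definition accurate (R : realType) (alpha c delta : R) (N : nat)
    (G : digraph N) (s : 'I_N) (est : 'I_N -> R) : Prop :=
  forall v, delta <= ppr alpha G s v ->
    `|est v - ppr alpha G s v| <= c * ppr alpha G s v.

Inductive query (N : nat) :=
| Jump
| Indeg of 'I_N
| Outdeg of 'I_N
| AdjIn of 'I_N & nat
| AdjOut of 'I_N & nat.

Inductive response (N : nat) :=
| Coin of bool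
| Node of 'I_N
| Degree of nat
| Refused.

(* [Flip b] tosses a private coin showing [true] with probability b; it is not
   a query and costs nothing. *)
Inductive action (R : realType) (N : nat) :=
| Flip of {i01 R}
| Ask of query N
| Output of ('I_N -> R).

Arguments Jump {N}.
Arguments Coin {N}.
Arguments Degree {N}.
Arguments Refused {N}.
Arguments Flip {R N}.
Arguments Ask {R N}.

(* The next action as a function of the source node and of the responses
   (coin tosses included) received so far, in chronological order.  An
   algorithm knows the label set 'I_N, may be nonuniform, and may diverge. *)
Definition algorithm (R : realType) :=
  forall N : nat, 'I_N -> seq (response N) -> action R N.

(* A query about a node that is not covered, or about an edge index out of
   range, is refused: it has a cost but carries no information on the graph. *)
Definition adj_reply (N : nat) (C : {set 'I_N}) (v : 'I_N) (l : seq 'I_N)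
    (i : nat) : response N :=
  if v \in C then (if onth l i is Some w then Node w else Refused)
  else Refused.

Definition deg_reply (N : nat) (C : {set 'I_N}) (v : 'I_N) (l : seq 'I_N) :
    response N :=
  if v \in C then Degree (size l) else Refused.

(* Expectation of F over the response to a query, C being the covered nodes. *)
Definition expect_reply (R : realType) (N : nat) (G : digraph N)
    (C : {set 'I_N}) (q : query N) (F : response N -> R) : R :=
  match q with
  | Jump => (\sum_(w < N) F (Node w)) / N%:R
  | Indeg v => F (deg_reply C v (in_nbrs G v))
  | Outdeg v => F (deg_reply C v (out_nbrs G v))
  | AdjIn v i => F (adj_reply C v (in_nbrs G v) i)
  | AdjOut v i => F (adj_reply C v (out_nbrs G v) i)
  end.

Definition expect_coin (R : realType) (N : nat) (b : {i01 R})
    (F : response N -> R) : R :=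
  b%:num * F (Coin true) + (1 - b%:num) * F (Coin false).

Definition cover (N : nat) (C : {set 'I_N}) (r : response N) : {set 'I_N} :=
  if r is Node w then w |: C else C.

(* Probability that, from covered set C and history h, the algorithm outputs
   an estimate satisfying [good] within k actions. *)
Fixpoint success_within (R : realType) (A : algorithm R) (N : nat)
    (G : digraph N) (s : 'I_N) (good : ('I_N -> R) -> Prop) (k : nat)
    (C : {set 'I_N}) (h : seq (response N)) : R :=
  if k is k'.+1 then
    let continue r :=
      success_within A G s good k' (cover C r) (rcons h r) in
    match A N s h with
    | Flip b => expect_coin b continue
    | Ask q => expect_reply G C q continue
    | Output est => (`[< good est >])%:R
    end
  else 0.

Definition success_prob (R : realType) (A : algorithm R) (N : nat)
    (G : digraph N) (s : 'I_N) (good : ('I_N -> R) -> Prop) : R :=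
  limn (fun k => success_within A G s good k [set s]%SET [::]).

(* Expected number of queries among the next k actions. *)
Fixpoint queries_within (R : realType) (A : algorithm R) (N : nat)
    (G : digraph N) (s : 'I_N) (k : nat) (C : {set 'I_N})
    (h : seq (response N)) : R :=
  if k is k'.+1 then
    let continue r := queries_within A G s k' (cover C r) (rcons h r) in
    match A N s h with
    | Flip b => expect_coin b continue
    | Ask q => 1 + expect_reply G C q continue
    | Output _ => 0
    end
  else 0.

Definition expected_queries (R : realType) (A : algorithm R) (N : nat)
    (G : digraph N) (s : 'I_N) : \bar R :=
  limn (fun k => (queries_within A G s k [set s]%SET [::])%:E).

(* Main.v *)
Require Import Defs.
From HB Require Import structures.
From mathcomp Require Import all_boot all_order all_algebra.
From mathcomp Require Import all_classical all_reals all_analysis.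
From mathcomp Require Import lra ring zify.
Set Implicit Arguments.
Unset Strict Implicit.
Unset Printing Implicit Defensive.
Import Order.TTheory GRing.Theory Num.Theory.
Import numFieldNormedType.Exports.
Local Open Scope classical_set_scope.
Local Open Scope ring_scope.

(* The hard instances form a family of graphs on 4r + 1 nodes, with r^2 of order
   B = min(m, log(1/delta)/delta).  The source feeds r hubs and every hub has r
   out-edges, one per target; a binary switch for each pair (hub, target) says
   whether this edge really enters the target, the edge of a decoy hub being swapped
   at the same time, so that all degrees are fixed and a query reveals at most one
   switch.  A target has PPR proportional to its number of open switches.  All
   targets get w0, of order log r, open switches in known places (PPR at least
   delta); independently and with a small constant probability beta, a target gets
   in addition 4 w0 open switches in random places.  An accurate estimate reveals
   which targets are of the second kind.
   Fewer than r^2/4 queries leave at least a quarter of the targets with less than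
   half of their switches read and no random open switch seen (few targets have such
   a switch at all, by Markov's inequality).  Given what was read, each of these is
   independently of either kind with probability at least beta / 4^(4 w0), which is
   much larger than 1/r because 4^(4 w0) <= sqrt r, so that all of them are guessed
   correctly with probability o(1). *)

(** * The graphs *)

Section FinDigraph.
Variables (V : finType) (out inn : V -> seq V).
Hypotheses (out_uniq : forall v, uniq (out v)) (inn_uniq : forall v, uniq (inn v)).
Hypothesis mem_inn : forall u v, (u \in inn v) = (v \in out u).
Hypothesis out_neq0 : forall v, out v != [::].

Let rank_nbrs (nbrs : V -> seq V) (v : 'I_#|V|) : seq 'I_#|V| :=
  [seq enum_rank u | u <- nbrs (enum_val v)].

Lemma rank_nbrs_uniq nbrs v : (forall u, uniq (nbrs u)) -> uniq (rank_nbrs nbrs v).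
Proof. by move=> nbrs_uniq; rewrite map_inj_uniq //; exact: enum_rank_inj. Qed.

Lemma mem_rank_nbrs nbrs u v :
  (u \in rank_nbrs nbrs v) = (enum_val u \in nbrs (enum_val v)).
Proof.
by rewrite -{1}(enum_valK u) mem_map //; exact: enum_rank_inj.
Qed.

Lemma mem_rank_inn u v : (u \in rank_nbrs inn v) = (v \in rank_nbrs out u).
Proof. by rewrite !mem_rank_nbrs mem_inn. Qed.

Lemma rank_out_neq0 v : rank_nbrs out v != [::].
Proof. by rewrite /rank_nbrs; case: (out _) (out_neq0 (enum_val v)). Qed.

(** [digraph] only has ordinals as nodes; transport along [enum_rank] allows instances to be
    described on a structured finite type. *)
Definition fin_digraph : digraph #|V| :=
  Digraph (fun v => rank_nbrs_uniq v out_uniq) (fun v => rank_nbrs_uniq v inn_uniq)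
    mem_rank_inn rank_out_neq0.

Lemma n_edges_fin_digraph : n_edges fin_digraph = (\sum_(v : V) size (out v))%N.
Proof.
rewrite [RHS](reindex_onto (@enum_val V V) enum_rank) /=; last first.
  by move=> v _; exact: enum_rankK.
rewrite /n_edges; apply: eq_big => [v|v _]; first by rewrite enum_valK eqxx.
by rewrite /outdeg size_map.
Qed.

Lemma walk_at_fin_digraphS (R : realType) (alpha : R) s k v :
  walk_at alpha fin_digraph s k.+1 (enum_rank v) =
  \sum_(u <- inn v) walk_at alpha fin_digraph s k (enum_rank u) * (1 - alpha)
                    / (size (out u))%:R.
Proof.
rewrite [RHS]big_uniq //=.
rewrite [RHS](reindex_onto (@enum_val V V) enum_rank) /=; last first.
  by move=> u _; exact: enum_rankK.
apply: eq_big => [u|u _].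
  rewrite -[in LHS]mem_rank_inn mem_rank_nbrs enum_rankK enum_valK eqxx andbT.
  by [].
by rewrite enum_valK /outdeg /= size_map.
Qed.

End FinDigraph.

Section SwitchGraph.
Variables (r : nat) (r_gt0 : (0 < r)%N).

(* [None] is the source s.  [Some (false, true, j)] is a hub fed by s and
   [Some (false, false, j)] its decoy twin, which has no in-edges;
   [Some (true, true, i)] is a target and [Some (true, false, i)] its twin.  The
   switch x i j decides whether the hub j points to the target i and the decoy to
   the twin, or the other way round; it leaves all the degrees unchanged. *)
Definition switch_node := option (bool * bool * 'I_r).

Definition switch_out (x : 'I_r -> 'I_r -> bool) (v : switch_node) :
    seq switch_node :=
  match v with
  | None => [seq Some (false, true, j) | j <- enum 'I_r]
  | Some (false, b, j) => [seq Some (true, b == x i j, i) | i <- enum 'I_r]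
  | Some (true, b, i) => [:: v]
  end.

Definition switch_in (x : 'I_r -> 'I_r -> bool) (v : switch_node) :
    seq switch_node :=
  match v with
  | None => [::]
  | Some (false, b, j) => if b then [:: None] else [::]
  | Some (true, b, i) => v :: [seq Some (false, b == x i j, j) | j <- enum 'I_r]
  end.

Lemma switch_out_uniq x v : uniq (switch_out x v).
Proof.
case: v => [[[[] b] i]|] //=; rewrite map_inj_uniq ?enum_uniq //.
- by move=> i1 i2 [].
- by move=> i1 i2 [].
Qed.

Lemma switch_in_uniq x v : uniq (switch_in x v).
Proof.
case: v => [[[[] b] i]|] //=; last by case: b.
rewrite map_inj_uniq ?enum_uniq ?andbT; last by move=> i1 i2 [].
by apply/mapP => -[].
Qed.

Lemma mem_switch_in x u v : (u \in switch_in x v) = (v \in switch_out x u).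
Proof.
case: v => [[[[] b] i]|]; case: u => [[[[] b'] i']|] //=.
- rewrite !inE [RHS]eq_sym.
  by case: eqP => //= _; apply/mapP => -[].
- rewrite inE /=; apply/mapP/mapP => -[j _ []] => [-> ->|-> ->].
    by exists i; rewrite ?mem_enum //; case: b; case: (x i j).
  by exists i'; rewrite ?mem_enum //; case: b'; case: (x j i').
- by rewrite inE /=; apply/mapP/mapP => -[].
- by case: b; rewrite !inE.
- by case: b; rewrite !inE /=; apply/esym/mapP => -[].
- case: b; first by rewrite inE eqxx; apply/esym/mapP; exists i; rewrite ?mem_enum.
  by rewrite in_nil; apply/esym/mapP => -[].
- by apply/esym/mapP => -[].
- by apply/esym/mapP => -[].
Qed.

Lemma switch_out_neq0 x v : switch_out x v != [::].
Proof.
case: v => [[[[] b] i]|] //=; rewrite -size_eq0 size_map size_enum_ord -lt0n //.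
Qed.

Definition switch_graph x : digraph #|{: switch_node}| :=
  fin_digraph (switch_out_uniq x) (switch_in_uniq x) (mem_switch_in x)
    (switch_out_neq0 x).

Definition switch_source : 'I_#|{: switch_node}| := enum_rank None.

Definition switch_target (i : 'I_r) : 'I_#|{: switch_node}| :=
  enum_rank (Some (true, true, i)).

Lemma card_switch_node : #|{: switch_node}| = (4 * r).+1.
Proof. by rewrite card_option !card_prod card_bool card_ord. Qed.

Lemma size_switch_out x v : size (switch_out x v) =
  if v is Some (true, _, _) then 1%N else r.
Proof. by case: v => [[[[] b] i]|] //=; rewrite size_map size_enum_ord. Qed.

Lemma size_switch_in x v : size (switch_in x v) =
  match v with
  | None => 0%N | Some (false, b, _) => b | Some (true, _, _) => r.+1
  end.
Proof.
case: v => [[[[] b] i]|] //=; last by case: b.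
by rewrite size_map size_enum_ord.
Qed.

Lemma n_edges_switch_graph x : (n_edges (switch_graph x) <= 5 * r ^ 2)%N.
Proof.
rewrite n_edges_fin_digraph.
under eq_bigr do rewrite size_switch_out.
rewrite (bigD1 None) //= (reindex_omap (@Some _) id) /=; last first.
  by case.
under eq_bigl do rewrite eqxx.
rewrite (eq_bigr (fun p : bool * bool * 'I_r => if p.1.1 then 1 else r)%N);
  last by move=> [[[] b] i].
rewrite -(pair_bigA _ (fun (p : bool * bool) (_ : 'I_r) => if p.1 then 1 else r)%N).
rewrite -(pair_bigA _ (fun a _ : bool => \sum_(j < r) if a then 1 else r)%N) /=.
rewrite !big_bool /= !sum_nat_const !card_ord.
(* [r] edges leave the source, [2 * r ^ 2] leave the hubs and decoys, and [2 * r] are self-loops. *)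
by nia.
Qed.

(** * The walk on a switch graph and the PPR of the targets *)

Section Walk.
Variables (R : realType) (alpha : R) (x : 'I_r -> 'I_r -> bool).

Let walk k v := walk_at alpha (switch_graph x) switch_source k (enum_rank v).

Lemma walk_switch0 v : walk 0 v = (v == None)%:R.
Proof. by rewrite /walk /= (inj_eq enum_rank_inj). Qed.

Lemma walk_switchS k v : walk k.+1 v =
  \sum_(u <- switch_in x v) walk k u * (1 - alpha) / (size (switch_out x u))%:R.
Proof. exact: walk_at_fin_digraphS. Qed.

Lemma walk_switch_source k : walk k None = (k == 0)%:R.
Proof.
by case: k => [|k]; rewrite ?walk_switch0 // walk_switchS big_nil.
Qed.

Lemma walk_switch_hub k b j :
  walk k (Some (false, b, j)) = ((k == 1%N) && b)%:R * ((1 - alpha) / r%:R).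
Proof.
case: k => [|k]; first by rewrite walk_switch0 mul0r.
rewrite walk_switchS /=; case: b; last by rewrite big_nil andbF mul0r.
rewrite big_seq1 walk_switch_source size_switch_out andbT eqSS.
by rewrite -!mulrA.
Qed.

(** A target is first entered at step 2, through a hub whose switch is open; its self-loop then
    keeps the walk there, at a factor [1 - alpha] per step. *)
Lemma walk_switch_target k i :
  walk k (Some (true, true, i)) =
  if (k < 2)%N then 0
  else (1 - alpha) ^+ k / r%:R ^+ 2 * #|[pred j | x i j]|%:R.
Proof.
elim: k => [|k IHk]; first by rewrite walk_switch0.
rewrite walk_switchS big_cons big_map big_enum IHk size_switch_out /= divr1.
under eq_bigr do rewrite walk_switch_hub size_map size_enum_ord.
case: k IHk => [|[|k]] _ /=.
- by rewrite mul0r add0r big1 // => j _; rewrite !mul0r.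
- rewrite mul0r add0r -sum1_card natr_sum mulr_sumr [RHS]big_mkcond /=.
  apply: eq_bigr => j _; rewrite inE; case: (x i j) => /=.
    by rewrite -exprVn; ring.
  by rewrite !mul0r.
- rewrite big1 ?addr0 => [|j _]; last by rewrite !mul0r.
  by rewrite [in RHS]exprSr; ring.
Qed.

Lemma ppr_switch_target i : 0 < alpha < 1 ->
  ppr alpha (switch_graph x) switch_source (switch_target i) =
  (1 - alpha) ^+ 2 / r%:R ^+ 2 * #|[pred j | x i j]|%:R.
Proof.
move=> /andP[alpha_gt0 alpha_lt1]; set W := RHS.
apply/cvg_lim => //.
(* The first two terms vanish and the others are geometric, whence a closed form of the partial
   sums. *)
rewrite -(cvg_shiftn 2).
have -> : (fun n => series (fun k => walk_at alpha (switch_graph x)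
    switch_source k (switch_target i) * alpha) (n + 2)%N) =
    (fun n => W - W * (1 - alpha) ^+ n).
  apply/funext => n; elim: n => [|n IHn].
    rewrite add0n seriesEnat /= !big_nat_recl // big_geq //=.
    have := walk_switch_target 0 i; rewrite /walk /= => ->.
    have := walk_switch_target 1 i; rewrite /walk /= => ->.
    by rewrite !mul0r !addr0 mulr1 subrr.
  rewrite addSn seriesEnat /= big_nat_recr //=.
  move: IHn; rewrite seriesEnat /= => ->.
  have := walk_switch_target (n + 2) i; rewrite /walk => ->.
  rewrite addn2 /= /W !exprSr; ring.
suff : (fun n => W - W * (1 - alpha) ^+ n) @ \oo --> W - W * 0.
  by rewrite mulr0 subr0.
apply: cvgB; first exact: cvg_cst.
apply: cvgM; first exact: cvg_cst.
apply: cvg_expr; rewrite ger0_norm; lra.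
Qed.

End Walk.

(* Only an adjacency query to a hub or a target can depend on the switches, and it
   then depends on a single one. *)
Lemma expect_reply_switch (R : realType) (C : {set 'I_#|{: switch_node}|}) q :
  q = Jump \/ exists i j (f : bool -> response #|{: switch_node}|),
    forall x F, expect_reply (switch_graph x) C q F = F (f (x i j)) :> R.
Proof.
have i0 : 'I_r := Ordinal r_gt0.
have adjP (nbrs : ('I_r -> 'I_r -> bool) -> switch_node -> seq switch_node) v k :
  (exists i j (f : bool -> option switch_node),
    forall x, onth (nbrs x (enum_val v)) k = f (x i j)) ->
  exists i j (f : bool -> response #|{: switch_node}|), forall x,
    adj_reply C v [seq enum_rank u | u <- nbrs x (enum_val v)] k = f (x i j).
  move=> [i [j [f nbrsE]]]; exists i, j, (fun b =>
    if v \in C then (if f b is Some w then Node (enum_rank w) else Refused)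
    else Refused) => x.
  by rewrite /adj_reply onth_map nbrsE; case: (f _).
case: q => [|v|v|v k|v k]; [by left|right..] => /=.
(* Degrees do not depend on the switches, so a degree reply can be computed on any member of the
   family. *)
- exists i0, i0, (fun _ => deg_reply C v (in_nbrs (switch_graph (fun _ _ => true)) v)).
  by move=> x F; rewrite /deg_reply /= !size_map !size_switch_in.
- exists i0, i0, (fun _ => deg_reply C v (out_nbrs (switch_graph (fun _ _ => true)) v)).
  by move=> x F; rewrite /deg_reply /= !size_map !size_switch_out.
- have [|i [j [f fE]]] := adjP switch_in v k.
    case: (enum_val v) => [[[[] b] i]|] /=.
    + case: k => [|k]; first by exists i0, i0, (fun _ => Some (Some (true, b, i))).
      (* If the index is out of range, [nth] names an arbitrary switch, but [onth] is [None] and the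
         reply ignores it. *)
      exists i, (nth i0 (enum 'I_r) k), (fun c =>
        omap (fun j => Some (false, b == c, j)) (onth (enum 'I_r) k)) => x /=.
      rewrite onth_map; case onth_k: (onth _ k) => [l|] //=.
      by rewrite (onth_nth i0 _ _ _ onth_k).
    + by exists i0, i0, (fun _ => onth (if b then [:: None] else [::]) k).
    + by exists i0, i0, (fun _ => None) => x; case: k.
  by exists i, j, f => x F; rewrite fE.
- have [|i [j [f fE]]] := adjP switch_out v k.
    case: (enum_val v) => [[[[] b] j]|] /=.
    + by exists i0, i0, (fun _ => onth [:: Some (true, b, j)] k).
    + exists (nth i0 (enum 'I_r) k), j, (fun c =>
        omap (fun i => Some (true, b == c, i)) (onth (enum 'I_r) k)) => x /=.
      rewrite onth_map; case onth_k: (onth _ k) => [l|] //=.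
      by rewrite (onth_nth i0 _ _ _ onth_k).
    + by exists i0, i0, (fun _ => onth [seq Some (false, true, j) | j <- enum 'I_r] k).
  by exists i, j, f => x F; rewrite fE.
Qed.

End SwitchGraph.

(** * Expected gain of an algorithm against a random graph *)

Section Runs.
Variables (R : realType) (N : nat).
Implicit Types (b : {i01 R}) (F : response N -> R).

Lemma le_expect_coin b F1 F2 :
  (forall x, F1 x <= F2 x) -> expect_coin b F1 <= expect_coin b F2.
Proof.
move=> F12; apply: lerD; apply: ler_wpM2l; rewrite ?subr_ge0 //; exact: F12.
Qed.

Lemma expect_coin_cst b a : @expect_coin R N b (fun _ => a) = a.
Proof. by rewrite /expect_coin -mulrDl addrC subrK mul1r. Qed.

Variables (G : digraph N) (s : 'I_N).

Lemma le_expect_reply C q F1 F2 :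
  (forall x, F1 x <= F2 x) -> expect_reply G C q F1 <= expect_reply G C q F2.
Proof.
move=> F12; case: q => //= *; apply: ler_wpM2r; first by rewrite invr_ge0.
exact: ler_sum.
Qed.

Lemma expect_reply_cst C q a : expect_reply G C q (fun _ => a) = a :> R.
Proof.
case: q => //=; rewrite sumr_const card_ord -[a *+ N]mulr_natr mulfK //.
by rewrite pnatr_eq0; case: N s => -[].
Qed.

Variables (A : algorithm R) (good : ('I_N -> R) -> Prop).

Lemma success_within_ge0 k C h : 0 <= success_within A G s good k C h.
Proof.
elim: k C h => //= k IHk C h; case: (A s h) => [b|q|est]; last exact: ler0n.
  by rewrite -(expect_coin_cst b 0); apply: le_expect_coin.
by rewrite -(expect_reply_cst C q 0); apply: le_expect_reply.
Qed.

Lemma success_within_le1 k C h : success_within A G s good k C h <= 1.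
Proof.
elim: k C h => //= k IHk C h; case: (A s h) => [b|q|est]; last by case: `[< _ >].
  by rewrite -(expect_coin_cst b 1); apply: le_expect_coin.
by rewrite -(expect_reply_cst C q 1); apply: le_expect_reply.
Qed.

Lemma success_withinS k C h :
  success_within A G s good k C h <= success_within A G s good k.+1 C h.
Proof.
elim: k C h => [|k IHk] C h; first exact: success_within_ge0.
rewrite [leLHS]/= [leRHS]/=; case: (A s h) => [b|q|est] //.
  by apply: le_expect_coin => x; exact: IHk.
by apply: le_expect_reply => x; exact: IHk.
Qed.

Lemma queries_within_ge0 k C h : 0 <= queries_within A G s k C h.
Proof.
elim: k C h => //= k IHk C h; case: (A s h) => [b|q|est] //.
  by rewrite -(expect_coin_cst b 0); apply: le_expect_coin.
by rewrite addr_ge0 // -(expect_reply_cst C q 0); apply: le_expect_reply.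
Qed.

Lemma queries_withinS k C h :
  queries_within A G s k C h <= queries_within A G s k.+1 C h.
Proof.
elim: k C h => [|k IHk] C h; first exact: queries_within_ge0.
rewrite [leLHS]/= [leRHS]/=; case: (A s h) => [b|q|est] //.
  by apply: le_expect_coin => x; exact: IHk.
by apply: lerD => //; apply: le_expect_reply => x; exact: IHk.
Qed.

Lemma success_prob_cvg :
  (fun k => success_within A G s good k [set s]%SET [::]) @ \oo -->
  success_prob A G s good.
Proof.
apply: (@nondecreasing_is_cvgn R).
  by apply/nondecreasing_seqP => k; exact: success_withinS.
exists 1 => _ [k _ <-]; exact: success_within_le1.
Qed.

Lemma queries_within_le_expected k :
  ((queries_within A G s k [set s]%SET [::])%:E <= expected_queries A G s)%E.
Proof.
rewrite /expected_queries (cvg_lim _ (ereal_nondecreasing_cvgn _)) //.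
  by apply: ereal_sup_ubound; exists k.
by apply/nondecreasing_seqP => j; rewrite lee_fin; exact: queries_withinS.
Qed.

End Runs.

(** * Averaging over a prior on the instances *)

Section Adversary.
Variables (R : realType) (A : algorithm R) (N : nat) (Y E : finType).
Variables (G : Y -> digraph N) (s : 'I_N) (good : Y -> ('I_N -> R) -> Prop).
Variables (x : Y -> E -> bool).
Variables (mu Z : Y -> R) (theta lambda : R).

(** The instances still possible once the switches in [Q] have been read as in [y0]. Sums over this
    cell are unnormalized conditional expectations, meaningful even for a cell of mass zero. *)
Definition agree (Q : {set E}) (y0 y : Y) : bool :=
  [forall e in Q, x y e == x y0 e].

Hypothesis mu_ge0 : forall y, 0 <= mu y.
Hypothesis Z_ge0 : forall y, 0 <= Z y.
Hypotheses (theta_ge0 : 0 <= theta) (lambda_ge0 : 0 <= lambda).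
Hypothesis replyE : forall C q, q = Jump \/ exists e (f : bool -> response N),
  forall y F, expect_reply (G y) C q F = F (f (x y e)) :> R.
Hypothesis output_le : forall (Q : {set E}) y0 est,
  \sum_(y | agree Q y0 y) mu y * ((`[< good y est >])%:R - Z y) <=
  (theta + lambda * #|Q|%:R) * \sum_(y | agree Q y0 y) mu y.

(** A Lagrangian payoff: each query is priced [lambda]. The penalty [Z] is paid whatever the
    algorithm does; it absorbs the lucky readings, so that [output_le] can be required of every
    cell. *)
Let gain k C h y : R :=
  success_within A (G y) s (good y) k C h - lambda * queries_within A (G y) s k C h
  - Z y.

Lemma agreeU1 Q y0 y1 e y : agree Q y0 y1 ->
  agree (e |: Q)%SET y1 y = agree Q y0 y && (x y e == x y1 e).
Proof.
move=> /forall_inP agree01; apply/forall_inP/andP => [agree1|[agree0 xe] e'].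
  split; last by apply: agree1; rewrite setU11.
  apply/forall_inP => e' Qe'; rewrite -(eqP (agree01 _ Qe')).
  by apply: agree1; rewrite inE Qe' orbT.
rewrite 2!inE => /predU1P[-> //|Qe'].
by rewrite (eqP (agree01 _ Qe')); move/forall_inP : agree0; apply.
Qed.

(* The right-hand side is a potential which grows by [lambda] per queried switch,
   that is, by the price of the query on the left-hand side. *)
Lemma sum_gain_le k C h Q y0 :
  \sum_(y | agree Q y0 y) mu y * gain k C h y <=
  (theta + lambda * #|Q|%:R) * \sum_(y | agree Q y0 y) mu y.
Proof.
have pot_ge0 (Q' : {set E}) : 0 <= theta + lambda * #|Q'|%:R.
  by rewrite addr_ge0 // mulr_ge0.
elim: k C h Q y0 => [|k IHk] C h Q y0.
  apply: (@le_trans _ _ 0); last by rewrite mulr_ge0 // sumr_ge0.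
  apply: sumr_le0 => y _; rewrite mulr_ge0_le0 // /gain /=.
  by rewrite mulr0 subr0 sub0r oppr_le0.
case Ah: (A s h) => [b|q|est]; last first.
- rewrite /gain /= Ah; apply: le_trans (output_le Q y0 est).
  by apply: ler_sum => y _; rewrite mulr0 subr0.
- set S := \sum_(y | agree Q y0 y) mu y.
  (* JUMP reveals nothing about the instance: the induction hypothesis is averaged over the sampled
     node, and the price is a pure loss. *)
  have [qJ|[e [f fE]]] := replyE C q.
    have N_neq0 : N%:R != 0 :> R by rewrite pnatr_eq0; case: N s => -[].
    have -> : \sum_(y | agree Q y0 y) mu y * gain k.+1 C h y =
        (\sum_(w < N) \sum_(y | agree Q y0 y)
          mu y * gain k (w |: C)%SET (rcons h (Node w)) y) / N%:R - lambda * S.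
      rewrite exchange_big mulr_suml /= mulr_sumr -sumrB; apply: eq_bigr => y _.
      rewrite /gain /= Ah qJ /= -mulr_sumr.
      rewrite sumrB sumrB -mulr_sumr sumr_const card_ord -[Z y *+ N]mulr_natr.
      by field.
    rewrite lerBlDr (@le_trans _ _ ((theta + lambda * #|Q|%:R) * S)) //.
      rewrite ler_pdivrMr ?lt0r ?N_neq0 ?ler0n // [leRHS]mulr_natr.
      have -> a : a *+ N = \sum_(w < N) a :> R by rewrite sumr_const card_ord.
      by apply: ler_sum => w _; exact: IHk.
    by rewrite lerDl mulr_ge0 // sumr_ge0.
  pose gain' b y := gain k (Defs.cover C (f b)) (rcons h (f b)) y.
  have -> : \sum_(y | agree Q y0 y) mu y * gain k.+1 C h y =
      \sum_(y | agree Q y0 y) mu y * gain' (x y e) y - lambda * S.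
    rewrite mulr_sumr -sumrB; apply: eq_bigr => y _.
    rewrite /gain' /gain /= Ah !fE; ring.
  (* The value of [e] splits the cell in two. On each half the reply is fixed, and the induction
     hypothesis applies to [e |: Q], which has at most one more element than [Q]. *)
  have half b : \sum_(y | agree Q y0 y && (x y e == b)) mu y * gain' (x y e) y <=
      (theta + lambda * #|Q|%:R + lambda) *
      \sum_(y | agree Q y0 y && (x y e == b)) mu y.
    rewrite (eq_bigr (fun y => mu y * gain' b y)); last first.
      by move=> y /andP[_ /eqP ->].
    have [y1 /andP[agree01 /eqP xe]|no_y] :=
      pickP (fun y => agree Q y0 y && (x y e == b)); last first.
      by rewrite !big_pred0 // mulr0.
    have agreeE y : agree Q y0 y && (x y e == b) = agree (e |: Q)%SET y1 y.
      by rewrite (agreeU1 _ _ agree01) xe.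
    rewrite !(eq_bigl _ _ agreeE) (le_trans (IHk _ _ _ _)) //.
    rewrite ler_wpM2r ?sumr_ge0 // -addrA lerD2l.
    rewrite -[X in _ + X]mulr1 -mulrDr ler_wpM2l // natr1 ler_nat.
    by rewrite cardsU1; case: (e \notin Q).
  have split_e (F : Y -> R) : \sum_(y | agree Q y0 y) F y =
      \sum_(y | agree Q y0 y && (x y e == true)) F y +
      \sum_(y | agree Q y0 y && (x y e == false)) F y.
    rewrite (bigID (fun y => x y e)) /=; congr (_ + _).
      by apply: eq_bigl => y; rewrite eqb_id.
    by apply: eq_bigl => y; rewrite eqbF_neg.
  rewrite lerBlDr -mulrDl /S !split_e mulrDr; apply: lerD; exact: half.
- have -> : \sum_(y | agree Q y0 y) mu y * gain k.+1 C h y =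
      b%:num * (\sum_(y | agree Q y0 y) mu y * gain k C (rcons h (Coin true)) y) +
      (1 - b%:num) *
        (\sum_(y | agree Q y0 y) mu y * gain k C (rcons h (Coin false)) y).
    rewrite !mulr_sumr -big_split; apply: eq_bigr => y _ /=.
    rewrite /gain /= Ah /expect_coin /=; ring.
  set S := _ * \sum_(y | _) mu y.
  have -> : S = b%:num * S + (1 - b%:num) * S by ring.
  apply: lerD; apply: ler_wpM2l; rewrite ?subr_ge0 //; exact: IHk.
Qed.

Hypothesis sum_mu : \sum_y mu y = 1.

(** Yao's averaging: bounds valid for every instance are averaged over [mu] and compared, for runs
    of [k] actions, through [sum_gain_le] with no switch read yet; then [k] tends to infinity. *)
Lemma success_le_queries (p M : R) :
  (forall y, 1 - p <= success_prob A (G y) s (good y)) ->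
  (forall y, (expected_queries A (G y) s <= M%:E)%E) ->
  1 - p <= theta + lambda * M + \sum_y mu y * Z y.
Proof.
move=> succ queries.
have cvg_avg : (fun k => \sum_y mu y *
    success_within A (G y) s (good y) k [set s]%SET [::]) @ \oo -->
    \sum_y mu y * success_prob A (G y) s (good y).
  apply: (@cvg_big R Y +%R 0 xpredT (@add_continuous R) nat \oo (index_enum Y)
    (fun y k => mu y * success_within A (G y) s (good y) k [set s]%SET [::])) => y _.
  by apply: cvgM; [exact: cvg_cst|exact: success_prob_cvg].
apply: (@le_trans _ _ (\sum_y mu y * success_prob A (G y) s (good y))).
  have <- : (\sum_y mu y) * (1 - p) = 1 - p by rewrite sum_mu mul1r.
  rewrite mulr_suml; apply: ler_sum => y _; exact: ler_wpM2l.
rewrite -(cvg_lim _ cvg_avg) //; apply: limr_le.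
  by apply/cvg_ex; eexists; exact: cvg_avg.
apply: nearW => k.
have [y0 _|Y0] := pickP Y; last first.
  by move/eqP: sum_mu; rewrite big_pred0 // eq_sym oner_eq0.
have := sum_gain_le k [set s]%SET [::] finset.set0 y0.
have agreeT y : agree finset.set0 y0 y by apply/forall_inP => e; rewrite inE.
rewrite !(eq_bigl _ _ agreeT) sum_mu cards0 mulr0 addr0 mulr1 => sum_le.
have : \sum_y mu y * queries_within A (G y) s k [set s]%SET [::] <= M.
  rewrite -[leRHS]mul1r -sum_mu mulr_suml; apply: ler_sum => y _.
  rewrite ler_wpM2l // -lee_fin (le_trans _ (queries y)) //.
  exact: queries_within_le_expected.
move=> /(ler_wpM2l lambda_ge0) queries_le.
rewrite (le_trans _ (lerD (lerD sum_le queries_le) (lexx _))) //.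
rewrite mulr_sumr -!big_split /=; apply: ler_sum => y _; rewrite /gain le_eqVlt.
by apply/orP; left; apply/eqP; ring.
Qed.

End Adversary.

(** * The prior on the switches *)

(** Falling factorials are compared factor by factor: [r - m <= 4 * (n - m)] for [m < w]. This
    bounds from below the proportion of [w]-sets that avoid what was read. *)
Lemma bin_le_exp4_bin r n w : (r <= 4 * (n - w))%N ->
  ('C(r, w) <= 4 ^ w * 'C(n, w))%N.
Proof.
move=> r_le; rewrite -(leq_pmul2r (fact_gt0 w)) -mulnA !bin_ffact.
elim: {-2}w (leqnn w) => // m IHm lt_mw.
rewrite !ffactnSr expnSr -mulnA (mulnA 4) (mulnC 4) -mulnA mulnA.
by apply: leq_mul; [apply: IHm|]; lia.
Qed.

(** By induction, since [(1 - a) * (1 + (n + 1) * a) = 1 + n * a - (n + 1) * a ^ 2]. It makes a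
    power of [1 - a] at most of order [1 / (n * a)]. *)
Lemma bernoulli_inv (R : realFieldType) (a : R) n : 0 <= a <= 1 ->
  (1 - a) ^+ n * (1 + n%:R * a) <= 1.
Proof.
move=> /andP[a_ge0 a_le1]; elim: n => [|n IHn]; first by rewrite expr0; lra.
apply: le_trans IHn; rewrite exprSr -mulrA ler_wpM2l ?exprn_ge0 ?subr_ge0 //.
rewrite -natr1; have n_ge0 : 0 <= n%:R :> R by [].
by nra.
Qed.

Section Prior.
Variables (R : realType) (r w0 : nat) (beta : R).
Hypotheses (w0_gt0 : (0 < w0)%N) (w0_le : (16 * w0 <= r)%N).
Hypothesis beta_itv : 0 < beta <= 2^-1.

Let w := (4 * w0)%N.

(* Each target is fed by the first w0 hubs; with probability beta, independently
   of the others, it is moreover fed by a uniformly random set of w = 4 w0 hubs. *)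
Definition feeds (S : {set 'I_r}) (j : 'I_r) : bool := (j < w0)%N || (j \in S).

Definition target_prior (S : {set 'I_r}) : R :=
  if S == finset.set0 then 1 - beta
  else if #|S| == w then beta / 'C(r, w)%:R else 0.

Definition prior (y : {ffun 'I_r -> {set 'I_r}}) : R :=
  \prod_i target_prior (y i).

(** Scaled to reach 1 when a quarter of the targets have random switches, with mean only [4 * beta]:
    Markov's inequality in additive form. *)
Definition penalty (y : {ffun 'I_r -> {set 'I_r}}) : R :=
  4 / r%:R * #|[pred i | y i != finset.set0]|%:R.

Let beta_gt0 : 0 < beta. Proof. by case/andP: beta_itv. Qed.
Let r_gt0 : (0 < r)%N. Proof. by lia. Qed.
Let rR_gt0 : 0 < r%:R :> R. Proof. by rewrite ltr0n. Qed.
Let binR_gt0 : 0 < 'C(r, w)%:R :> R.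
Proof. by rewrite ltr0n bin_gt0 /w; lia. Qed.

Lemma target_prior_ge0 S : 0 <= target_prior S.
Proof.
rewrite /target_prior; case: ifP => _; first by case/andP: beta_itv => *; lra.
by case: ifP => // _; rewrite divr_ge0 // ltW.
Qed.

Lemma prior_ge0 y : 0 <= prior y.
Proof. by apply: prodr_ge0 => i _; exact: target_prior_ge0. Qed.

Lemma penalty_ge0 y : 0 <= penalty y.
Proof. by rewrite mulr_ge0 // divr_ge0. Qed.

Lemma sum_target_prior_card (P : pred {set 'I_r}) :
  \sum_(S | (S != finset.set0) && P S) target_prior S =
  #|[set S : {set 'I_r} | P S & #|S| == w]%SET|%:R * (beta / 'C(r, w)%:R).
Proof.
rewrite mulr_natl -sumr_const [RHS]big_mkcond [LHS]big_mkcond /=.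
apply: eq_bigr => S _; rewrite inE /target_prior.
case: eqVneq => [->|_] /=; last by case: (P S).
by rewrite cards0 ltn_eqF ?andbF // /w muln_gt0.
Qed.

Lemma sum_target_prior_neq0 :
  \sum_(S | S != finset.set0) target_prior S = beta.
Proof.
have := sum_target_prior_card xpredT; rewrite /=.
under eq_bigl do rewrite andbT.
move=> ->; have -> : #|[set S : {set 'I_r} | #|S| == w]%SET| = 'C(r, w).
  by rewrite card_draws card_ord.
by rewrite mulrC divfK // lt0r_neq0.
Qed.

Lemma sum_target_prior : \sum_S target_prior S = 1.
Proof.
rewrite (bigD1 finset.set0) //= sum_target_prior_neq0 /target_prior eqxx.
by rewrite subrK.
Qed.

Lemma sum_prior : \sum_y prior y = 1.
Proof.
rewrite -(bigA_distr_bigA (fun _ S => target_prior S)) big1 // => i _.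
exact: sum_target_prior.
Qed.

Lemma sum_prior_penalty : \sum_y prior y * penalty y = 4 * beta.
Proof.
have marginal i : \sum_y prior y * (y i != finset.set0)%:R = beta.
  (* [F] puts the indicator into the [i]-th factor, so that the expectation is again a product over
     the targets. *)
  pose F k S := target_prior S * (if k == i then (S != finset.set0)%:R else 1).
  rewrite (eq_bigr (fun y : {ffun _ -> _} => \prod_k F k (y k))) => [|y _].
    rewrite -(bigA_distr_bigA F) (bigD1 i) //= [X in _ * X]big1 ?mulr1.
      rewrite -[RHS]sum_target_prior_neq0 [RHS]big_mkcond; apply: eq_bigr => S _.
      by rewrite /F eqxx; case: (S != _); rewrite ?mulr1 ?mulr0.
    move=> k /negPf ki; rewrite -[RHS]sum_target_prior; apply: eq_bigr => S _.
    by rewrite /F ki mulr1.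
  rewrite big_split /=; congr (_ * _).
  by rewrite -big_mkcond big_pred1_eq.
rewrite (eq_bigr (fun y => 4 / r%:R *
  \sum_(i < r) (prior y * (y i != finset.set0)%:R))) => [|y _].
  rewrite -mulr_sumr exchange_big /= (eq_bigr _ (fun i _ => marginal i)).
  rewrite sumr_const card_ord -[beta *+ r]mulr_natl mulrA divfK //.
  exact: lt0r_neq0.
rewrite -mulr_sumr /penalty -sum1_card natr_sum [in LHS]big_mkcond /=.
rewrite mulrCA; congr (_ * (_ * _)).
by apply: eq_bigr => i _; rewrite inE; case: (_ != _).
Qed.

(** The mass that either kind of target retains at least, when less than half of its switches are
    read and no random one was seen open. *)
Let a : R := beta / 4 ^+ w.

Lemma prior_bias_itv : 0 < a <= 2^-1.
Proof.
case/andP: beta_itv => ? ble; rewrite divr_gt0 ?exprn_gt0 //=.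
apply: le_trans ble; rewrite ler_pdivrMr ?exprn_gt0 //.
by rewrite ler_peMr ?exprn_ege1 // ?ltW //; lra.
Qed.

Let reading (y : {ffun 'I_r -> {set 'I_r}}) (e : 'I_r * 'I_r) :=
  feeds (y e.1) e.2.

(** * The posterior given a set of readings *)

Section Consistent.
Variables (Q : {set 'I_r * 'I_r}) (y0 : {ffun 'I_r -> {set 'I_r}}).

Definition consistent (i : 'I_r) (S : {set 'I_r}) : bool :=
  [forall j, ((i, j) \in Q) ==> (feeds S j == feeds (y0 i) j)].

Lemma agree_family y : agree reading Q y0 y = (y \in family consistent).
Proof.
apply/forall_inP/familyP => [agree_y i|cons_y [i j] Qij].
  by apply/forallP => j; apply/implyP => /agree_y.
by have /forallP/(_ j)/implyP/(_ Qij) := cons_y i.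
Qed.

(** The readings constrain each target separately, so a cell is a product set and the targets stay
    independent given the readings. *)
Lemma sum_agree_prior :
  \sum_(y | agree reading Q y0 y) prior y =
  \prod_i \sum_(S | consistent i S) target_prior S.
Proof.
rewrite (bigA_distr_big_dep consistent (fun _ S => target_prior S)).
exact: eq_bigl agree_family.
Qed.

Let column i := [set j | (i, j) \in Q]%SET.
(** The first [w0] switches are open for both kinds, so only an open switch beyond them betrays the
    kind. *)
Let hit i := [exists j in column i, (w0 <= j)%N && (j \in y0 i)].

(** The empty set is consistent, with mass [1 - beta >= 1/2 >= a]; so are the [w]-sets disjoint from
    the column, with mass at least [a]. Either guess [b] thus misses mass at least [a] out of a
    total at most 1. *)
Lemma sum_consistent_le i b : ~~ hit i -> (2 * #|column i| < r)%N ->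
  \sum_(S | consistent i S && ((S != finset.set0) == b)) target_prior S <=
  (1 - a) * \sum_(S | consistent i S) target_prior S.
Proof.
move=> no_hit light.
have [a_gt0 a_le] := andP prior_bias_itv.
have feeds0 j : (i, j) \in Q -> feeds (y0 i) j = (j < w0)%N.
  move=> Qij; rewrite /feeds; case: ltnP => //= w0_le_j.
  apply: contraNF no_hit => y0j; apply/exists_inP; exists j; first by rewrite inE.
  by rewrite w0_le_j.
have cons0 : consistent i finset.set0.
  apply/forallP => j; apply/implyP => Qij.
  by rewrite feeds0 // /feeds inE orbF.
have disjoint_cons (S : {set 'I_r}) : S \subset (~: column i)%SET -> consistent i S.
  move=> /fintype.subsetP sub; apply/forallP => j; apply/implyP => Qij.
  rewrite feeds0 // /feeds; case: (boolP (j \in S)); last by rewrite orbF.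
  by move=> /sub; rewrite !inE Qij.
set p1 := \sum_(S | (S != finset.set0) && consistent i S) target_prior S.
have p1_ge : a <= p1.
  rewrite /p1 sum_target_prior_card.
  rewrite /a mulrCA ler_pM2l // ler_pdivlMr // mulrC ler_pdivrMr ?exprn_gt0 //.
  have card_le : ('C(#|~: column i|%SET, w) <=
      #|[set S : {set 'I_r} | consistent i S & #|S| == w]%SET|)%N.
    rewrite -cards_draws; apply/subset_leq_card/fintype.subsetP => S; rewrite !inE.
    by move=> /andP[/disjoint_cons -> ->].
  rewrite -natrX -natrM ler_nat mulnC.
  apply: leq_trans (leq_mul (leqnn _) card_le).
  (* More than [r / 2] hubs are unread and [w <= r / 4]. *)
  apply: bin_le_exp4_bin; have := cardsC (column i); rewrite card_ord /w.
  by lia.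
have p1_le : p1 <= beta.
  rewrite -sum_target_prior_neq0 [leRHS](bigID (consistent i)) /= lerDl.
  by apply: sumr_ge0 => S _; exact: target_prior_ge0.
have -> : \sum_(S | consistent i S) target_prior S = 1 - beta + p1.
  rewrite (bigD1 finset.set0) //= {1}/target_prior eqxx; congr (_ + _).
  by apply: eq_bigl => S; rewrite andbC.
case: b.
  rewrite (_ : \sum_(S | _) _ = p1); last first.
    by apply: eq_bigl => S; rewrite eqb_id andbC.
  by case/andP: beta_itv => *; nra.
rewrite (_ : \sum_(S | _) _ = 1 - beta); first by nra.
rewrite (big_pred1 finset.set0) => [|S]; first by rewrite /target_prior eqxx.
rewrite eqbF_neg negbK /=; case: eqVneq => [->|]; first by rewrite cons0.
by rewrite andbF.
Qed.

(** A hit depends only on what was read, so it shows a nonempty random set in every [y] of the cell,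
    not just in [y0]. *)
Lemma hit_penalty y : agree reading Q y0 y ->
  4 / r%:R * #|[pred i | hit i]|%:R <= penalty y.
Proof.
move=> agree_y; rewrite ler_wpM2l ?divr_ge0 // ler_nat.
apply/subset_leq_card/fintype.subsetP => i; rewrite !inE => /exists_inP[j].
rewrite inE => Qij /andP[w0_le_j y0j].
have /forall_inP/(_ _ Qij) := agree_y; rewrite /reading /feeds /= y0j orbT.
rewrite ltnNge w0_le_j /= => /eqP yj.
by apply: contraTneq yj => ->; rewrite inE.
Qed.

Lemma sum_card_column : (\sum_i #|column i| = #|Q|)%N.
Proof.
rewrite (eq_bigr (fun i => \sum_j if (i, j) \in Q then 1 else 0)%N) => [|i _].
  rewrite pair_bigA -[RHS]sum1_card [RHS]big_mkcond /=.
  by apply: eq_bigr => -[].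
by rewrite -sum1_card big_mkcond /=; apply: eq_bigr => j _; rewrite inE.
Qed.

(** Fewer than half of the targets can have half of their switches in [Q], and fewer than a quarter
    are hit. *)
Lemma card_light : (4 * #|Q| < r ^ 2)%N -> (4 * #|[pred i | hit i]| < r)%N ->
  (r <= 4 * #|[pred i | ~~ hit i & 2 * #|column i| < r]|)%N.
Proof.
move=> Q_small hit_small.
pose heavy := [pred i | r <= 2 * #|column i|]%N.
have heavy_le : (r * #|heavy| <= 2 * #|Q|)%N.
  rewrite -sum_card_column big_distrr /= mulnC -sum_nat_const.
  rewrite [leqRHS](bigID (mem heavy)) /= (leq_trans _ (leq_addr _ _)) //.
  by apply: leq_sum => i; rewrite inE.
have heavy_lt : (2 * #|heavy| < r)%N.
  by rewrite -(ltn_pmul2l r_gt0); nia.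
have : (r <= #|[pred i | hit i]| + #|heavy| +
    #|[pred i | ~~ hit i & 2 * #|column i| < r]|)%N.
  rewrite -[leqLHS]card_ord -[leqLHS]sum1_card -!sum1_card.
  rewrite [in X in (_ <= X)%N]big_mkcond [in X in (_ <= _ + X + _)%N]big_mkcond.
  rewrite [in X in (_ <= _ + _ + X)%N]big_mkcond -!big_split /=.
  apply: leq_sum => i _; rewrite !inE; case: (hit i) => //=.
  by case: (ltnP _ r).
by lia.
Qed.

Variables (est : Type) (good : {ffun 'I_r -> {set 'I_r}} -> est -> Prop).
Variable decode : est -> 'I_r -> bool.
Hypothesis decodeP : forall y e, good y e ->
  (forall i, y i = finset.set0 \/ #|y i| = w) ->
  forall i, (y i != finset.set0) = decode e i.

(** A good output fixes the kind of every target, so the sum factors over the targets; each unhit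
    target with a light column contributes a factor [1 - a]. *)
Lemma sum_good_le e :
  \sum_(y | agree reading Q y0 y) prior y * (`[< good y e >])%:R <=
  (1 - a) ^+ #|[pred i | ~~ hit i & 2 * #|column i| < r]%N| *
  \sum_(y | agree reading Q y0 y) prior y.
Proof.
pose Qd i S := consistent i S && ((S != finset.set0) == decode e i).
have [a_gt0 a_le] := andP prior_bias_itv.
apply: (@le_trans _ _ (\sum_(y in family Qd) prior y)).
  rewrite [leLHS]big_mkcond [leRHS]big_mkcond /=; apply: ler_sum => y _.
  rewrite agree_family; case: ifP => [/familyP cons_y|_]; last first.
    by case: ifP => // _; exact: prior_ge0.
  (* [decodeP] asks for sets of size 0 or [w]; any other [y] has prior zero. *)
  have [prior0|prior_neq0] := eqVneq (prior y) 0.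
    by rewrite prior0 mul0r; case: ifP.
  case: asboolP => [good_y|_]; last first.
    by rewrite mulr0; case: ifP => // _; exact: prior_ge0.
  rewrite mulr1 ifT //; apply/familyP => i.
  apply/andP; split; first exact: cons_y.
  rewrite (decodeP good_y) // => k.
  move: prior_neq0 => /prodf_neq0/(_ k isT); rewrite /target_prior.
  case: (y k =P finset.set0) => [|_]; first by left.
  by case: (#|y k| =P w) => [|_]; [right|rewrite eqxx].
rewrite sum_agree_prior -(bigA_distr_big_dep Qd (fun _ S => target_prior S)).
rewrite -prodr_const [X in X * _]big_mkcond -big_split /=.
apply: ler_prod => i _; apply/andP; split.
  by apply: sumr_ge0 => S _; exact: target_prior_ge0.
rewrite inE; case: ifP => [/andP[no_hit light]|_]; first exact: sum_consistent_le.
rewrite mul1r [leRHS](bigID (fun S => (S != finset.set0) == decode e i)) /= lerDl.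
by apply: sumr_ge0 => S _; exact: target_prior_ge0.
Qed.

(** Three cases: if [Q] has at least [r ^ 2 / 4] elements, its term is at least 1; if a quarter of
    the targets are hit, the penalty is at least 1; otherwise at least [r / 4] kinds are guessed,
    with success at most [4 / (r * a)]. *)
Lemma prior_output_le e :
  \sum_(y | agree reading Q y0 y) prior y * ((`[< good y e >])%:R - penalty y) <=
  (4 / (r%:R * a) + 4 / r%:R ^+ 2 * #|Q|%:R) *
  \sum_(y | agree reading Q y0 y) prior y.
Proof.
have [a_gt0 a_le] := andP prior_bias_itv.
have theta_ge0 : 0 <= 4 / (r%:R * a) by rewrite divr_ge0 // mulr_ge0 // ltW.
have lambda_ge0 : 0 <= 4 / r%:R ^+ 2 * #|Q|%:R :> R.
  by rewrite mulr_ge0 // divr_ge0 // exprn_ge0.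
have [Q_big|Q_small] := leqP (r ^ 2)%N (4 * #|Q|)%N.
  rewrite mulr_sumr; apply: ler_sum => y _; rewrite mulrC.
  apply: ler_wpM2r; first exact: prior_ge0.
  apply: (@le_trans _ _ 1).
    have := penalty_ge0 y; case: `[< _ >] => /=; lra.
  rewrite ler_wpDl // mulrAC ler_pdivlMr ?exprn_gt0 // mul1r.
  by rewrite -natrX -natrM ler_nat.
have [hit_big|hit_small] := leqP r (4 * #|[pred i | hit i]|)%N.
  apply: (@le_trans _ _ 0); last first.
    by rewrite mulr_ge0 ?addr_ge0 // sumr_ge0 // => y _; exact: prior_ge0.
  apply: sumr_le0 => y /hit_penalty pen; rewrite mulr_ge0_le0 ?prior_ge0 //.
  have : 1 <= penalty y.
    apply: le_trans pen; rewrite mulrAC ler_pdivlMr // mul1r.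
    by rewrite -natrM ler_nat.
  by case: `[< _ >] => /=; lra.
apply: (@le_trans _ _ (\sum_(y | agree reading Q y0 y)
    prior y * (`[< good y e >])%:R)).
  apply: ler_sum => y _; rewrite ler_wpM2l ?prior_ge0 // gerBl.
  exact: penalty_ge0.
apply: le_trans (sum_good_le e) _; apply: ler_wpM2r.
  by rewrite sumr_ge0 // => y _; exact: prior_ge0.
rewrite ler_wpDr // ler_pdivlMr ?mulr_gt0 //.
have := card_light Q_small hit_small; set n := #|_| => r_le.
have a01 : 0 <= a <= 1 by apply/andP; lra.
have := bernoulli_inv n a01.
have : 0 <= (1 - a) ^+ n by rewrite exprn_ge0 //; lra.
have : r%:R <= 4 * n%:R :> R by rewrite -natrM ler_nat.
move: ((1 - a) ^+ n) => t r_le' t_ge0 bern.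
have : t * (r%:R * a) <= t * (4 * n%:R * a).
  by rewrite ler_wpM2l // ler_wpM2r // ltW.
by nra.
Qed.

End Consistent.
End Prior.

(** * The bound for the family and the choice of its size *)

Section FamilyBound.
Variables (R : realType) (alpha c delta beta p M : R) (r w0 : nat).
Hypotheses (w0_gt0 : (0 < w0)%N) (w0_le : (16 * w0 <= r)%N).
Hypothesis beta_itv : 0 < beta <= 2^-1.
Hypotheses (halpha : 0 < alpha < 1) (hc : 0 < c <= 2^-1).
Hypothesis delta_le : delta <= (1 - alpha) ^+ 2 / r%:R ^+ 2 * w0%:R.
Hypothesis r_gt0 : (0 < r)%N.

Let G (y : {ffun 'I_r -> {set 'I_r}}) :=
  switch_graph r_gt0 (fun i j => feeds w0 (y i) j).
Let good y := accurate alpha c delta (G y) (switch_source r).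
Let mass : R := (1 - alpha) ^+ 2 / r%:R ^+ 2.

Lemma card_feeds0 : #|[pred j | feeds w0 (@finset.set0 'I_r) j]| = w0.
Proof.
have w0_le_r : (w0 <= r)%N by lia.
rewrite -sum1_card (eq_bigl (fun j : 'I_r => j < w0)%N) => [|j].
  by rewrite -(big_ord_widen r (fun _ => 1)%N w0_le_r) sum1_card card_ord.
by rewrite !inE /feeds inE orbF.
Qed.

(* The PPR of a target is [w0 * mass] or at least [4 * w0 * mass], so that relative
   error 1/2 tells the two cases apart. *)
Lemma accurate_decodes y est : good y est ->
  (forall i, y i = finset.set0 \/ #|y i| = (4 * w0)%N) ->
  forall i, (y i != finset.set0) = (2 * w0%:R * mass <= est (switch_target i)).
Proof.
move=> good_y y_card i.
have mass_gt0 : 0 < mass.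
  by rewrite divr_gt0 ?exprn_gt0 ?ltr0n //; case/andP: halpha => *; lra.
have w0R_gt0 : 0 < w0%:R :> R by rewrite ltr0n.
have mw_gt0 : 0 < mass * w0%:R by rewrite mulr_gt0.
have w0_card : (w0 <= #|[pred j | feeds w0 (y i) j]|)%N.
  rewrite -[leqLHS]card_feeds0; apply/subset_leq_card/fintype.subsetP => j.
  by rewrite !inE /feeds inE orbF => ->.
have := good_y (switch_target i); rewrite ppr_switch_target // -/mass.
have mass_le : mass * w0%:R <= mass * #|[pred j | feeds w0 (y i) j]|%:R.
  by rewrite ler_pM2l // ler_nat.
move=> /(_ (le_trans delta_le mass_le)); move: mass_le.
set W := mass * #|_|%:R => W_ge /ler_normlP[est_lo est_hi].
have W_gt0 : 0 < W by apply: lt_le_trans W_ge; rewrite mulr_gt0.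
have cW : c * W <= 2^-1 * W by case/andP: hc => _ ?; rewrite ler_pM2r.
(* The estimate is at most [3/2 * w0 * mass] in the first case and at least [2 * w0 * mass] in the
   second. *)
case: eqVneq => [yi|yi_neq0] /=.
  have W_eq : W = mass * w0%:R by rewrite /W yi card_feeds0.
  by apply/esym/negbTE; rewrite -ltNge; nra.
apply/esym; have card_yi : #|y i| = (4 * w0)%N.
  by case: (y_card i) => // yi; rewrite yi eqxx in yi_neq0.
have : mass * (4 * w0%:R) <= W.
  rewrite ler_pM2l // -natrM -card_yi ler_nat.
  by apply/subset_leq_card/fintype.subsetP => j; rewrite !inE /feeds orbC => ->.
by nra.
Qed.

Lemma switch_family_bound (A : algorithm R) :
  (forall y, 1 - p <= success_prob A (G y) (switch_source r) (good y)) ->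
  (forall y, (expected_queries A (G y) (switch_source r) <= M%:E)%E) ->
  1 - p <= 4 / (r%:R * (beta / 4 ^+ (4 * w0))) + 4 / r%:R ^+ 2 * M + 4 * beta.
Proof.
move=> succ queries; have [beta_gt0 beta_le] := andP beta_itv.
rewrite -(sum_prior_penalty w0_gt0 w0_le beta_itv).
apply: (@success_le_queries _ A _ _ ('I_r * 'I_r)%type G (switch_source r) good
  (fun y e => feeds w0 (y e.1) e.2)) => //.
- exact: prior_ge0.
- exact: penalty_ge0.
- apply: divr_ge0 => //; apply: mulr_ge0 => //; apply: divr_ge0; first exact: ltW.
  exact: exprn_ge0.
- move=> C q; have [->|[i [j [f fE]]]] := expect_reply_switch r_gt0 R C q.
    by left.
  by right; exists (i, j), f => y F; exact: fE.
- move=> Q y0 est.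
  exact: (prior_output_le w0_gt0 w0_le beta_itv Q y0 accurate_decodes).
- exact: sum_prior.
Qed.

End FamilyBound.

(** Either [d * B <= 1 <= ln B], or [d^-1 < B] and [d * B <= ln d^-1 <= ln B]. This removes [d] from
    the logarithm. *)
Lemma mul_le_ln (R : realType) (d B : R) : 0 < d -> expR 1 <= B ->
  B <= ln d^-1 / d -> d * B <= ln B.
Proof.
move=> d_gt0 eB B_le.
have B_gt0 : 0 < B by apply: lt_le_trans eB; exact: expR_gt0.
have dV_gt0 : 0 < d^-1 by rewrite invr_gt0.
have [dB_le1|dB_gt1] := leP (d * B) 1.
  apply: le_trans dB_le1 _.
  by rewrite -[leLHS]expRK ler_ln ?posrE ?expR_gt0.
apply: (@le_trans _ _ (ln d^-1)); first by rewrite mulrC -ler_pdivlMr.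
by rewrite ler_ln ?posrE // -[leLHS]mul1r ler_pdivrMr // mulrC ltW.
Qed.

Lemma ln_nat_le (R : realType) (r n : nat) : (0 < r)%N -> (r <= 2 ^ n)%N ->
  ln r%:R <= n%:R :> R.
Proof.
move=> r_gt0 r_le; rewrite -[leRHS]expRK ler_ln ?posrE ?expR_gt0 ?ltr0n //.
apply: (@le_trans _ _ (2 ^+ n)); first by rewrite -natrX ler_nat.
rewrite -[n%:R]mulr1 expRM_natl lerXn2r ?nnegrE ?expR_ge0 //.
by apply: le_trans (expR_ge1Dx 1); lra.
Qed.

(* With w0 about log2(r) / 16 the bias 4 ^ (4 * w0) stays below sqrt(r). *)
Lemma exists_family_size (R : realType) (alpha p : R) :
  0 < alpha < 1 -> 0 < p < 1 ->
  exists B0 kappa : R, [/\ 0 < B0, 0 < kappa, kappa * B0 <= 1 &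
    forall d B, 0 < d -> B0 <= B -> B <= ln d^-1 / d ->
    exists r w0 : nat, [/\ (0 < w0)%N, (16 * w0 <= r)%N, r%:R ^+ 2 <= B,
      d <= (1 - alpha) ^+ 2 / r%:R ^+ 2 * w0%:R &
      4 / (r%:R * ((1 - p) / 16 / 4 ^+ (4 * w0))) + 4 / r%:R ^+ 2 * (kappa * B)
        <= (1 - p) / 2]].
Proof.
move=> /andP[alpha_gt0 alpha_lt1] /andP[p_gt0 p_lt1].
have div16 k : (16 <= k -> k.+1 <= 32 * (k %/ 16))%N by lia.
have mul16 k : (2 * (4 * k * 2) = 16 * k)%N by lia.
(* 96 is 3 times 32, from [ln B <= 3 * ln r] and [ln r <= 32 * w0]. *)
pose c0 : R := (1 - alpha) ^+ 2 / 96.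
have c0_gt0 : 0 < c0 by rewrite divr_gt0 // exprn_gt0 // subr_gt0.
have c0_le1 : c0 <= 1.
  rewrite ler_pdivrMr // mul1r (@le_trans _ _ 1) ?exprn_ile1 //; lra.
(* Chosen so that [t * 4 ^+ (4 * w0) <= r] makes the guessing term at most [(1 - p) / 4]. *)
pose t : R := 256 / (1 - p) ^+ 2.
have t_gt0 : 0 < t by rewrite divr_gt0 // exprn_gt0 // subr_gt0.
(* The summands ensure, in order, [w0 > 0], [B <= r ^+ 3] and [t <= sqrt r]. *)
pose R0 : R := 2 ^+ 16 + 4 / c0 + t ^+ 2.
have c4_gt0 : 0 < 4 / c0 by rewrite divr_gt0.
have t2_gt0 : 0 < t ^+ 2 by rewrite exprn_gt0.
have two16_gt0 : 0 < 2 ^+ 16 :> R by rewrite exprn_gt0.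
have R0_gt0 : 0 < R0 by rewrite !addr_gt0.
(* [expR 1] serves [mul_le_ln]; the 1 added to [R0] makes up for truncating the square root that
   defines [r]. *)
pose B0 : R := expR 1 + (R0 + 1) ^+ 2 / c0.
have B0_gt0 : 0 < B0.
  by rewrite addr_gt0 ?expR_gt0 // divr_gt0 // exprn_gt0 // addr_gt0.
(* The first bound settles the case [B < B0], the second makes the query term at most
   [(1 - p) / 4]. *)
pose kappa : R := Num.min B0^-1 ((1 - p) * c0 / 64).
have kappa_gt0 : 0 < kappa.
  rewrite lt_min invr_gt0 B0_gt0 divr_gt0 // mulr_gt0 // subr_gt0 //.
exists B0, kappa; split => //.
  by rewrite -ler_pdivlMr // mul1r ge_min lexx.
move=> d B d_gt0 B0_le B_le.
have B_gt0 : 0 < B by exact: lt_le_trans B0_le.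
have cB_ge0 : 0 <= c0 * B by rewrite mulr_ge0 // ltW.
pose r := Num.truncn (Num.sqrt (c0 * B)).
have := truncn_itv (sqrtr_ge0 (c0 * B)); rewrite -/r => /andP[r_le r_lt].
have r2_le : r%:R ^+ 2 <= c0 * B.
  by rewrite -[leRHS]sqr_sqrtr // lerXn2r // nnegrE ?sqrtr_ge0.
have r_ge : R0 <= r%:R.
  have : R0 + 1 <= Num.sqrt (c0 * B).
    have R01_ge0 : 0 <= R0 + 1 by rewrite addr_ge0 // ltW.
    rewrite -[leLHS]ger0_norm // -sqrtr_sqr ler_wsqrtr //.
    by rewrite [leRHS]mulrC -ler_pdivrMr // (le_trans _ B0_le) // lerDr expR_ge0.
  by move=> R01; have := le_lt_trans R01 r_lt; rewrite -natr1 ltrD2r => /ltW.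
have r_ge16 : (2 ^ 16 <= r)%N.
  by rewrite -(ler_nat R) natrX (le_trans _ r_ge) // /R0 -addrA lerDl addr_ge0 ?ltW.
have r_ge4 : 4 / c0 <= r%:R by apply: le_trans r_ge; rewrite /R0; lra.
have r_get : t ^+ 2 <= r%:R by apply: le_trans r_ge; rewrite /R0; lra.
have r_gt0 : (0 < r)%N by apply: leq_trans r_ge16; rewrite expn_gt0.
have rR_gt0 : 0 < r%:R :> R by rewrite ltr0n.
have rR_ge1 : 1 <= r%:R :> R by rewrite ler1n.
have B_lt : B <= 4 / c0 * r%:R ^+ 2.
  rewrite mulrAC ler_pdivlMr // mulrC.
  rewrite -[leLHS]sqr_sqrtr // (_ : 4 * _ = (2 * r%:R) ^+ 2); last by ring.
  rewrite lerXn2r ?nnegrE ?sqrtr_ge0 ?mulr_ge0 // (le_trans (ltW r_lt)) //.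
  by rewrite -natr1; lra.
pose l := trunc_log 2 r; pose w0 := (l %/ 16)%N.
have l_ge : (16 <= l)%N by exact: trunc_log_max.
have w0_gt0 : (0 < w0)%N by rewrite divn_gt0.
have /andP[l_le l_lt] : (2 ^ l <= r < 2 ^ l.+1)%N by exact: trunc_log_bounds.
have w0_l : (16 * w0 <= l)%N by rewrite mulnC leq_divM.
have w0R_gt0 : 0 < w0%:R :> R by rewrite ltr0n.
exists r, w0; split => //.
- by apply: leq_trans w0_l _; apply: leq_trans l_le; apply: ltnW; apply: ltn_expl.
- by apply: le_trans r2_le _; rewrite ler_piMl // ltW.
- rewrite mulrAC ler_pdivlMr ?exprn_gt0 //.
  have ln_r : ln r%:R <= 32 * w0%:R :> R.
    rewrite -natrM; apply: ln_nat_le => //; apply: leq_trans (ltnW l_lt) _.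
    by rewrite leq_exp2l // div16.
  have ln_B : ln B <= 3 * ln r%:R.
    rewrite mulr_natl -lnXn // ler_ln ?posrE ?exprn_gt0 //.
    by apply: le_trans B_lt _; rewrite exprS ler_wpM2r ?exprn_ge0.
  have dB : d * B <= ln B.
    apply: mul_le_ln => //; apply: le_trans B0_le.
    by rewrite lerDl divr_ge0 ?exprn_ge0 ?addr_ge0 // ltW.
  apply: (@le_trans _ _ (d * (c0 * B))); first by rewrite ler_pM2l.
  have -> : (1 - alpha) ^+ 2 = c0 * 96 by rewrite divfK.
  by rewrite mulrCA -[leRHS]mulrA ler_pM2l //; lra.
- have kB : 4 / r%:R ^+ 2 * (kappa * B) <= (1 - p) / 4.
    rewrite mulrAC ler_pdivrMr ?exprn_gt0 //.
    apply: (@le_trans _ _ (4 * ((1 - p) * c0 / 64 * (4 / c0 * r%:R ^+ 2)))).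
      rewrite ler_pM2l // ler_pM //; first exact: ltW.
        exact: ltW.
      by rewrite ge_min lexx orbT.
    rewrite (_ : 4 * _ = (1 - p) / 4 * r%:R ^+ 2) //.
    by field; rewrite lt0r_neq0.
  have bias : t * 4 ^+ (4 * w0) <= r%:R.
    have bias_gt0 : 0 < 4 ^+ (4 * w0) :> R by rewrite exprn_gt0.
    have bias2 : (4 ^+ (4 * w0)) ^+ 2 <= r%:R :> R.
      rewrite -exprM (_ : 4 = 2 ^+ 2); last by ring.
      rewrite -exprM -natrX ler_nat; apply: leq_trans l_le.
      by rewrite leq_exp2l // mul16.
    by nra.
  rewrite (_ : (1 - p) / 2 = (1 - p) / 4 + (1 - p) / 4); last by field.
  apply: lerD => //.
  have p1_gt0 : 0 < 1 - p by rewrite subr_gt0.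
  rewrite ler_pdivrMr ?mulr_gt0 ?divr_gt0 ?exprn_gt0 //.
  have bias_gt0 : 0 < 4 ^+ (4 * w0) :> R by rewrite exprn_gt0.
  move: (4 ^+ (4 * w0)) bias bias_gt0 => q bias q_gt0.
  have scale_gt0 : 0 < (1 - p) / 16 / q by rewrite !divr_gt0.
  apply: (@le_trans _ _ ((1 - p) / 4 * (t * q * ((1 - p) / 16 / q)))); last first.
    by rewrite ler_pM2l ?divr_gt0 // ler_pM2r.
  rewrite le_eqVlt; apply/orP; left; apply/eqP; rewrite /t; field.
  by rewrite !lt0r_neq0.
Qed.

(* The [max 1] only matters where min(m, log(1/delta)/delta) is bounded by the
   constant 1/kappa, i.e. where the claim is an Omega(1) bound: for delta close
   to 1 a constant estimate can be accurate without any query. *)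
Theorem theorem1p6 (R : realType) (alpha p c : R) (delta m : nat -> R)
  (halpha : 0 < alpha < 1) (hp : 0 < p < 1) (hc : 0 < c <= 2^-1)
  (hdelta : forall n, 0 < delta n < 1)
  (hm0 : forall n, 0 <= m n)
  (hmOmega : (m : nat -> R^o) =Omega_\oo ((fun n => n%:R) : nat -> R^o))
  (hmO : (m : nat -> R^o) =O_\oo ((fun n => n%:R ^+ 2) : nat -> R^o)) :
  exists K kappa : R, [/\ 0 < K, 0 < kappa &
    \forall n \near \oo, forall A : algorithm R,
      (forall (N : nat) (G : digraph N) (s : 'I_N),
         (n_edges G)%:R <= K * m n -> N%:R <= K * n%:R ->
         1 - p <= success_prob A G s (accurate alpha c (delta n) G s)) ->
      exists (N : nat) (U : digraph N) (s : 'I_N),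
        [/\ (n_edges U)%:R <= K * m n, N%:R <= K * n%:R &
            ((kappa * Num.min (m n) (ln (delta n)^-1 / delta n))%:E
               <= maxe 1 (expected_queries A U s))%E]].
Proof.
have nodes5 r : (0 < r -> (4 * r).+1 <= 5 * r)%N by lia.
have [k k_gt0 m_ge] : exists2 k : R, 0 < k & \forall n \near \oo, k * n%:R <= m n.
  move: hmOmega; rewrite eqOmegaE qualifE => /asboolP[k k_gt0 m_ge].
  exists k => //; apply: filterS m_ge => n /=.
  by rewrite !ger0_norm.
have [C C_gt0 m_le] : exists2 C : R, 0 < C & \forall n \near \oo, m n <= C * n%:R ^+ 2.
  move: hmO => /eqO_exP[C C_gt0 m_le].
  exists C => //; apply: filterS m_le => n /=.
  by rewrite !ger0_norm // exprn_ge0.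
have [B0 [kappa [B0_gt0 kappa_gt0 kappaB0 sizeP]]] := exists_family_size halpha hp.
(* [5 * (C + 1)] serves the nodes, as [r <= (C + 1) * n]; [5 / k] gives [5 <= K * m n], which pays
   for the edges when [r = 1]. *)
pose K : R := 5 * (C + 1) + 5 / k.
have k5_gt0 : 0 < 5 / k by rewrite divr_gt0.
have K_ge5 : 5 <= K by rewrite /K; lra.
exists K, kappa; split => //; first by lra.
near=> n => A hA.
have n_gt0 : (0 < n)%N by near: n; exists 1%N.
have nR_ge1 : 1 <= n%:R :> R by rewrite ler1n.
have mk : k * n%:R <= m n by near: n.
have mC : m n <= C * n%:R ^+ 2 by near: n.
have /andP[d_gt0 d_lt1] := hdelta n.
have edges_le (r : nat) (r_gt0 : (0 < r)%N) x : r%:R ^+ 2 <= Num.max 1 (m n) ->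
    (n_edges (switch_graph r_gt0 x))%:R <= K * m n.
  move=> r2_le; apply: (@le_trans _ _ (5 * r%:R ^+ 2)).
    by rewrite -natrX -natrM ler_nat n_edges_switch_graph.
  have five_le : 5 <= K * m n.
    apply: (@le_trans _ _ (5 / k * (k * 1))); first by rewrite mulr1 divfK // lt0r_neq0.
    apply: ler_pM; [exact: ltW|by rewrite mulr1 ltW|by rewrite /K; lra|].
    by apply: le_trans mk; rewrite ler_pM2l.
  move: r2_le; rewrite le_max => /orP[r2_le|r2_le].
    by apply: le_trans five_le; lra.
  by apply: ler_pM => //; rewrite exprn_ge0.
have nodes_le (r : nat) : (0 < r)%N -> r%:R ^+ 2 <= Num.max 1 (m n) ->
    #|{: switch_node r}|%:R <= K * n%:R.
  move=> r_gt0 r2_le; rewrite card_switch_node.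
  have r_le : r%:R <= (C + 1) * n%:R.
    have C1_ge0 : 0 <= C + 1 by rewrite addr_ge0 // ltW.
    rewrite -(@ler_pXn2r _ 2) ?nnegrE ?mulr_ge0 //.
    apply: le_trans r2_le _; rewrite ge_max exprMn; apply/andP; split.
      by rewrite mulr_ege1 // exprn_ege1 //; lra.
    by apply: le_trans mC _; rewrite ler_wpM2r ?exprn_ge0 //; nra.
  apply: (@le_trans _ _ (5 * r%:R)); first by rewrite -natrM ler_nat nodes5.
  apply: (@le_trans _ _ (5 * ((C + 1) * n%:R))); first by rewrite ler_pM2l.
  by rewrite mulrA ler_wpM2r // /K; lra.
set B := Num.min _ _.
(* Below [B0] the claimed bound is at most 1, and the instance with [r = 1] suffices. *)
have [B_lt|B_ge] := ltP B B0.
  have one_le : 1%:R ^+ 2 <= Num.max 1 (m n) by rewrite expr1n le_max lexx.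
  exists _, (switch_graph (ltn0Sn 0) (fun _ _ => true)), (switch_source 1); split.
  - exact: edges_le.
  - exact: nodes_le.
  - rewrite le_max lee_fin; apply/orP; left; apply: le_trans kappaB0.
    by rewrite ler_pM2l // ltW.
have B_le : B <= ln (delta n)^-1 / delta n by rewrite ge_min lexx orbT.
have [r [w0 [w0_gt0 w0_le r2_le delta_le small]]] := sizeP _ _ d_gt0 B_ge B_le.
have r_gt0 : (0 < r)%N by apply: leq_trans w0_le; rewrite muln_gt0.
have r2_max : r%:R ^+ 2 <= Num.max 1 (m n).
  rewrite le_max; apply/orP; right; apply: (le_trans r2_le).
  by rewrite /B ge_min lexx.
pose G (y : {ffun 'I_r -> {set 'I_r}}) :=
  switch_graph r_gt0 (fun i j => feeds w0 (y i) j).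
have [y queries_ge] : exists y,
    ((kappa * B)%:E <= expected_queries A (G y) (switch_source r))%E.
  (* Otherwise, with [beta = (1 - p) / 16], the family bound would give
     [1 - p <= (1 - p) / 2 + (1 - p) / 4]. *)
  apply: contrapT => /forallNP no_y.
  have p_itv : 0 < (1 - p) / 16 <= 2^-1 by apply/andP; case/andP: hp; lra.
  have succ y : 1 - p <= success_prob A (G y) (switch_source r)
      (accurate alpha c (delta n) (G y) (switch_source r)).
    by apply: hA; [exact: edges_le|exact: nodes_le].
  have queries y :
      (expected_queries A (G y) (switch_source r) <= (kappa * B)%:E)%E.
    by have /negP := no_y y; rewrite -ltNge => /ltW.
  have := switch_family_bound w0_gt0 w0_le p_itv halpha hc delta_le succ queries.
  by move: small; case/andP: hp; lra.
exists _, (G y), (switch_source r); split.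
- exact: edges_le.
- exact: nodes_le.
- by rewrite le_max queries_ge orbT.
Unshelve. all: by end_near. Qed.
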